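(* Let $q=p^{t}$ be a prime power ($p$ prime, $t\geq1$), $m\geq 1$, and $0\leq\alpha_1\leq\alpha_2<m(q-1)$. Then there exists a $p$-ary asymmetric quantum code with parameters $[[tq^m,\ t[k(\alpha_2)-k(\alpha_1)],\ d_z/d_x]]_p$, where $$k(\alpha)=\sum_{i=0}^{m}(-1)^i\binom{m}{i}\binom{m+\alpha-iq}{\alpha-iq},$$ $d_z\geq d(\alpha_2)$ with $d(\alpha)=(s+1)q^{u}$ where $m(q-1)-\alpha=(q-1)u+s$ and $0\leq s<q-1$, and $d_x\geq d(\alpha_1^{\perp})=(a+1)q^{b}$, where $\alpha_1+1=(q-1)b+a$ and $0\leq a\leq q-1$.
   Context: An AQECC $[[n,k,d_z/d_x]]_p$ is a $p^k$-dimensional subspace of $\mathbb{C}^{p^n}$ correcting all qudit-flip errors up to $\lfloor (d_x-1)/2\rfloor$ and all phase-shift errors up to $\lfloor (d_z-1)/2\rfloor$. (For reference: $k(\alpha)$ and $d(\alpha)$ are the dimension and minimum distance of the generalized Reed–Muller code $\mathcal{R}_q(\alpha,m)$ of length $q^m$ and order $\alpha$ over $\mathbb{F}_q$, whose dual is $\mathcal{R}_q(m(q-1)-1-\alpha,m)$; binomial coefficients with negative lower entry are $0$.) *)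

(* Defs.v *)
From HB Require Import structures.
From mathcomp Require Import all_boot all_order all_algebra all_field.
Set Implicit Arguments. Unset Strict Implicit. Unset Printing Implicit Defensive.
Import Order.TTheory GRing.Theory Num.Theory.

Local Open Scope ring_scope.

(* k(alpha) = sum_{i=0}^m (-1)^i C(m,i) C(m+alpha-iq, alpha-iq),
   with binomials having a negative lower entry equal to 0. *)
Definition kRM (q m alpha : nat) : int :=
  \sum_(i < m.+1)
     ((-1) ^+ i * ('C(m, i))%:Z *
      (if (i * q <= alpha)%N then ('C(m + alpha - i * q, alpha - i * q))%:Z
       else 0)).

Definition dRM (q m alpha : nat) : nat :=
  let r := (m * (q - 1) - alpha)%N in
  ((r %% (q - 1)).+1 * q ^ (r %/ (q - 1)))%N.

(* (a+1) q^b where alpha1 + 1 = (q-1) b + a, 0 <= a <= q-1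
   (the value does not depend on the choice of a when two are possible;
    we take the one with a < q-1). *)
Definition dRMperp (q alpha1 : nat) : nat :=
  let r := alpha1.+1 in
  ((r %% (q - 1)).+1 * q ^ (r %/ (q - 1)))%N.

(* computational basis labels: F_p^n *)
Definition qlabel (p n : nat) := {ffun 'I_n -> 'F_p}.

(* states: vectors of C^{p^n}, i.e. functions F_p^n -> C *)
Definition qstate (p n : nat) := {ffun qlabel p n -> algC}.

Definition qinner (p n : nat) (u v : qstate p n) : algC :=
  \sum_(x : qlabel p n) (u x)^* * v x.

(* a fixed primitive p-th root of unity (p > 0 below since p prime) *)
Definition omega (p : nat) : algC := sval (C_prim_root_exists (ltn0Sn p.-1)).

Definition qwt (p n : nat) (a : qlabel p n) : nat := #|[set i | a i != 0]|.

Definition qdot (p n : nat) (b x : qlabel p n) : 'F_p := \sum_i b i * x i.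

Definition Zerr (p n : nat) (b : qlabel p n) (v : qstate p n) : qstate p n :=
  [ffun x : qlabel p n => omega p ^+ (nat_of_ord (qdot b x)) * v x].

(* qudit-flip error X(a) : |x> |-> |x + a> *)
Definition Xerr (p n : nat) (a : qlabel p n) (v : qstate p n) : qstate p n :=
  [ffun x : qlabel p n => v [ffun i => x i - a i]].

Definition Perr (p n : nat) (a b : qlabel p n) (v : qstate p n) : qstate p n :=
  Xerr a (Zerr b v).

(* A code of dimension K given by an orthonormal basis (its span is the
   code space) corrects all errors X(a)Z(b) with wt(a) <= tx and
   wt(b) <= tz iff the Knill--Laflamme conditions hold:
   <c_i| E1^dagger E2 |c_j> = c(E1,E2) delta_ij for all such E1, E2. *)
Definition corrects (p n K : nat) (c : 'I_K -> qstate p n) (tx tz : nat) :=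
  forall a1 b1 a2 b2 : qlabel p n,
    (qwt a1 <= tx)%N -> (qwt b1 <= tz)%N ->
    (qwt a2 <= tx)%N -> (qwt b2 <= tz)%N ->
    exists cE : algC, forall i j : 'I_K,
      qinner (Perr a1 b1 (c i)) (Perr a2 b2 (c j)) = if i == j then cE else 0.

(* [[n, k, dz/dx]]_p asymmetric quantum code: a p^k-dimensional subspace of
   C^{p^n} (given by an orthonormal basis) correcting all qudit-flip errors
   up to floor((dx-1)/2) and all phase-shift errors up to floor((dz-1)/2). *)
Definition is_AQECC (p n k dz dx : nat) : Prop :=
  exists c : 'I_(p ^ k) -> qstate p n,
    (forall i j, qinner (c i) (c j) = (i == j)%:R) /\
    corrects c (dx.-1./2) (dz.-1./2).

(* Main.v *)
Require Import Defs.
From HB Require Import structures.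
From mathcomp Require Import all_boot all_order all_algebra all_field.
From mathcomp Require Import ring zify.
Set Implicit Arguments. Unset Strict Implicit. Unset Printing Implicit Defensive.
Import Order.TTheory GRing.Theory Num.Theory.

Local Open Scope ring_scope.

(** This is the CSS construction. Put [N = m(q-1)], and let [D] and [E] be the
    [p]-ary expansions of the Reed-Muller codes of orders [N-1-alpha2] and
    [N-1-alpha1], so that [D] is contained in [E]. The code is spanned by the
    uniform superpositions of the cosets of [D] in [E], with the polynomials
    whose monomials have degree in [(N-1-alpha2, N-1-alpha1]] as coset
    representatives. Flips are detected by the minimum distance of [E]. Phase
    shifts are detected by the minimum distance of the dual of [D], since a
    nontrivial character of [D] sums to zero.

    Reduced monomials are handled through the pairing [sum_x f(x) g(x)]: if
    [x^e] has maximal degree in [f], pairing [f] with the complementary monomial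
    [x^(q-1-e)] returns the coefficient of [x^e] up to sign. Hence evaluation is
    injective, so bijective by counting, and the dual of the code of order
    [N-1-alpha] is the code of order [alpha]. The minimum distance is the
    footprint bound [prod_i (q - e_i)], minimized over exponents of given total
    degree.

    Expanding one code in an [F_p]-basis [(b_i)] of [F_q] and the other by
    [y |-> (lambda (b_i y))_i], for any nonzero linear form [lambda], turns the
    [F_q]-pairing into the [F_p]-pairing. *)

(** * Coset states *)

Section AdditiveCharacter.
Variable p : nat.
Hypothesis p_pr : prime p.

Definition addchar (x : 'F_p) : algC := omega p ^+ (nat_of_ord x).

Lemma omega_prim : p.-primitive_root (omega p).
Proof.
by rewrite /omega; case: C_prim_root_exists => z /=; rewrite prednK ?prime_gt0.
Qed.

Lemma addcharD x y : addchar (x + y) = addchar x * addchar y.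
Proof.
rewrite /addchar -exprD /= -[in RHS](prim_expr_mod omega_prim).
by congr (_ ^+ (_ %% _)); rewrite Fp_cast.
Qed.

Lemma addchar0 : addchar 0 = 1.
Proof. by []. Qed.

Lemma addchar_neq1 x : x != 0 -> addchar x != 1.
Proof.
apply: contraNneq => /eqP; rewrite /addchar -(prim_order_dvd omega_prim).
have ltxp : (x < p)%N by rewrite -[X in (_ < X)%N](Fp_cast p_pr) ltn_ord.
by rewrite /dvdn modn_small.
Qed.

Lemma conj_addchar x : (addchar x)^* = addchar (- x).
Proof.
have norm1 : `|addchar x| = 1.
  apply/eqP; rewrite -(pexpr_eq1 (prime_gt0 p_pr)) ?normr_ge0 // -normrX.
  by rewrite exprAC (prim_expr_order omega_prim) expr1n normr1.
have nz : addchar x != 0 by rewrite -normr_eq0 norm1 oner_eq0.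
apply: (mulfI nz); rewrite -normCK norm1 expr1n.
by rewrite -addcharD subrr addchar0.
Qed.

End AdditiveCharacter.

Section CosetStates.
Variables (p n : nat).
Hypothesis p_pr : prime p.
Local Notation V := (qlabel p n).

Lemma qdotDr (b x y : V) : qdot b (x + y) = qdot b x + qdot b y.
Proof.
by rewrite -big_split; apply: eq_bigr => i _; rewrite ffunE mulrDr.
Qed.

Lemma qdotBl (b c x : V) : qdot (b - c) x = qdot b x - qdot c x.
Proof.
by rewrite -sumrB; apply: eq_bigr => i _; rewrite !ffunE mulrBl.
Qed.

Lemma qdot0l (x : V) : qdot 0 x = 0.
Proof. by rewrite /qdot big1 // => i _; rewrite ffunE mul0r. Qed.

Lemma qwt0 : qwt (0 : V) = 0%N.
Proof.
by apply/eqP; rewrite cards_eq0; apply/eqP/setP => i; rewrite !inE ffunE eqxx.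
Qed.

Lemma qwtB (a b : V) : (qwt (a - b)%R <= qwt a + qwt b)%N.
Proof.
apply: leq_trans (leq_card_setU _ _); apply/subset_leq_card/subsetP => i.
rewrite !inE !ffunE; apply: contraNT; rewrite negb_or !negbK.
by move=> /andP[/eqP-> /eqP->]; rewrite subr0.
Qed.

Lemma qwtB_lt (d : nat) (a b : V) : (0 < d)%N ->
  (qwt a <= d.-1./2)%N -> (qwt b <= d.-1./2)%N -> (qwt (a - b)%R < d)%N.
Proof.
move=> d_gt0 wa wb; rewrite -(prednK d_gt0) ltnS.
apply: leq_trans (qwtB a b) (leq_trans (leq_add wa wb) _).
by rewrite addnn -{2}(odd_double_half d.-1) leq_addl.
Qed.

Lemma PerrE (a b : V) (v : qstate p n) x :
  Perr a b v x = addchar (qdot b (x - a)) * v (x - a).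
Proof.
rewrite !ffunE; suff -> : [ffun i => x i - a i] = x - a by [].
by apply/ffunP => i; rewrite !ffunE.
Qed.

Lemma Perr0 (v : qstate p n) : Perr 0 0 v = v.
Proof.
by apply/ffunP => x; rewrite PerrE subr0 qdot0l addchar0 mul1r.
Qed.

Variable D : {set V}.
Hypotheses (D0 : 0 \in D) (DB : forall x y, x \in D -> y \in D -> x - y \in D).

Lemma shift_closed y x : y \in D -> (x + y \in D) = (x \in D).
Proof.
move=> yD; apply/idP/idP => xD; first by rewrite -(addrK y x) DB.
by rewrite -[y]opprK DB // -sub0r DB.
Qed.

Definition coset_state (x : V) : qstate p n :=
  [ffun y : V => if y - x \in D then (sqrtC #|D|%:R)^-1 else 0].

(** Translating the summation variable by [y] multiplies the sum by [addchar (qdot b y)], which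
    differs from 1. *)
Lemma sum_addchar (b : V) (y : V) : y \in D -> qdot b y != 0 ->
  \sum_(x in D) addchar (qdot b x) = 0.
Proof.
move=> yD by0; apply/eqP; set S := (X in X == _).
have: S = addchar (qdot b y) * S.
  rewrite mulr_sumr /S (reindex_inj (addIr y)) /=.
  apply: eq_big => x; rewrite ?shift_closed // => _.
  by rewrite qdotDr addcharD // mulrC.
move/eqP; rewrite -subr_eq0 -[X in X - _]mul1r -mulrBl mulf_eq0 subr_eq0.
by rewrite eq_sym (negPf (addchar_neq1 p_pr by0)).
Qed.

Lemma coset_norm :
  (sqrtC #|D|%:R)^-1 ^* * (sqrtC #|D|%:R)^-1 * #|D|%:R = 1 :> algC.
Proof.
have D_gt0 : (0 : algC) < #|D|%:R by rewrite ltr0n; apply/card_gt0P; exists 0.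
rewrite mulrC [X in _ * X]mulrC -normCK normfV.
rewrite ger0_norm ?sqrtC_ge0 ?ltW // exprVn sqrtCK mulfV //.
by rewrite gt_eqF.
Qed.

(** The first hypothesis puts distinct words of the union of the cosets at distance at least [dx];
    the second gives the dual of [D] minimum distance at least [dz]. Distinct flips or distinct
    cosets then yield disjoint supports, and what remains is a character sum over [D]. *)
Lemma qinner_coset_state (I : eqType) (X : I -> V) (dx dz : nat) i j
    (a1 b1 a2 b2 : V) :
    (forall i j d, d \in D -> (qwt (X j - X i + d)%R < dx)%N ->
       i = j /\ X j - X i + d = 0) ->
    (forall b, b != 0 -> (qwt b < dz)%N -> exists2 y, y \in D & qdot b y != 0) ->
    (qwt (a1 - a2)%R < dx)%N -> (qwt (b2 - b1)%R < dz)%N ->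
  qinner (Perr a1 b1 (coset_state (X i))) (Perr a2 b2 (coset_state (X j))) =
    ((i == j) && ((a1 == a2) && (b1 == b2)))%:R.
Proof.
move=> minX minZ wa wb; rewrite /qinner.
have [/andP[/eqP<- /eqP<-] | neq] := boolP ((i == j) && (a1 == a2)); last first.
  rewrite andbA (negPf neq) big1 // => y _; rewrite !PerrE !ffunE.
  have [y1|_] := ifP; last by rewrite mulr0 conjC0 mul0r.
  have [y2|_] := ifP; last by rewrite !mulr0.
  (* A common support point [y] exhibits [a1 - a2] as a difference of words from the cosets [j] and
     [i]. *)
  have [|eqij] := @minX i j (y - a2 - X j - (y - a1 - X i)) (DB y2 y1).
    suff -> : X j - X i + (y - a2 - X j - (y - a1 - X i)) = a1 - a2 by [].
    by apply/ffunP => k; rewrite !ffunE; ring.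
  have -> : X j - X i + (y - a2 - X j - (y - a1 - X i)) = a1 - a2.
    by apply/ffunP => k; rewrite !ffunE; ring.
  by move/eqP; rewrite subr_eq0 => eqa; rewrite eqij eqxx eqa in neq.
rewrite !eqxx /= (reindex_inj (addIr (X i + a1))) /=.
transitivity (\sum_(x in D) (sqrtC #|D|%:R)^-1 ^* * (sqrtC #|D|%:R)^-1 *
    addchar (qdot (b2 - b1) (X i)) * addchar (qdot (b2 - b1) x)).
  rewrite [RHS]big_mkcond; apply: eq_bigr => x _; rewrite !PerrE !ffunE.
  have -> : x + (X i + a1) - a1 = x + X i by rewrite addrA addrK.
  rewrite addrK; case: ifP => _; last by rewrite !mulr0.
  rewrite rmorphM /= conj_addchar // !qdotBl !qdotDr opprD !addcharD //.
  ring.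
rewrite -mulr_sumr eq_sym.
have [->|neqb] := eqVneq b2 b1.
  under eq_bigr do rewrite subrr qdot0l addchar0.
  by rewrite subrr qdot0l addchar0 mulr1 sumr_const coset_norm.
have [|y yD by0] := minZ _ _ wb; first by rewrite subr_eq0.
by rewrite (sum_addchar yD by0) mulr0.
Qed.

Lemma coset_code_AQECC (k dz dx : nat) (X : 'I_(p ^ k) -> V) :
    (0 < dz)%N -> (0 < dx)%N ->
    (forall i j d, d \in D -> (qwt (X j - X i + d)%R < dx)%N ->
       i = j /\ X j - X i + d = 0) ->
    (forall b, b != 0 -> (qwt b < dz)%N -> exists2 y, y \in D & qdot b y != 0) ->
  is_AQECC p n k dz dx.
Proof.
move=> dz_gt0 dx_gt0 minX minZ; exists (fun i => coset_state (X i)); split.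
  move=> i j; rewrite -[coset_state (X i)]Perr0 -[coset_state (X j)]Perr0.
  by rewrite (qinner_coset_state _ _ minX minZ) ?subrr ?qwt0 // !eqxx !andbT.
move=> a1 b1 a2 b2 wa1 wb1 wa2 wb2.
exists ((a1 == a2) && (b1 == b2))%:R => i j.
by rewrite (qinner_coset_state _ _ minX minZ) ?qwtB_lt //; case: (i == j).
Qed.

End CosetStates.

(** * Monomials and the footprint *)

(* An iterated product rather than a type of finite functions, so that splitting
   off a variable is definitional. *)
Fixpoint power (T : finType) (m : nat) : finType :=
  if m is m'.+1 then (T * power T m')%type : finType else unit.

Lemma card_power (T : finType) m : #|power T m| = (#|T| ^ m)%N.
Proof.
by elim: m => [|m IHm] /=; rewrite ?card_unit // card_prod IHm expnS.
Qed.

Fixpoint mdeg (q m : nat) : power 'I_q m -> nat :=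
  if m is m'.+1 then fun e => (e.1 + mdeg e.2)%N else fun=> 0%N.

Fixpoint mcompl (q m : nat) : power 'I_q m -> power 'I_q m :=
  if m is m'.+1 then fun e => (rev_ord e.1, mcompl e.2) else id.

Lemma mdeg_compl q m (e : power 'I_q m) :
  (mdeg (mcompl e) + mdeg e = m * (q - 1))%N.
Proof.
elim: m e => [//|m IHm] [i e] /=.
by rewrite mulSn -(IHm e) addnACA; have := ltn_ord i; lia.
Qed.

Lemma mcomplK q m : involutive (@mcompl q m).
Proof. by elim: m => [//|m IHm] [i e] /=; rewrite rev_ordK IHm. Qed.

Section Distance.
Variable q : nat.
Hypothesis q_gt1 : (1 < q)%N.

(* For [r = (q-1)u + s] with [s < q-1] this is [(s+1) q^u], the least value of
   [prod_i (c_i + 1)] over [0 <= c_i <= q-1] with [sum_i c_i = r]. *)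
Definition min_dist (r : nat) : nat :=
  ((r %% (q - 1)).+1 * q ^ (r %/ (q - 1)))%N.

Lemma min_dist_gt0 r : (0 < min_dist r)%N.
Proof. by rewrite muln_gt0 /= expn_gt0; lia. Qed.

Lemma min_distE u s : (s < q - 1)%N ->
  min_dist (u * (q - 1) + s) = (s.+1 * q ^ u)%N.
Proof.
move=> ltsq; rewrite /min_dist modnMDl divnMDl ?modn_small ?divn_small ?addn0 //.
by lia.
Qed.

Lemma min_dist_decomp r :
  exists u s, (s < q - 1)%N /\ r = (u * (q - 1) + s)%N.
Proof.
exists (r %/ (q - 1))%N, (r %% (q - 1))%N; rewrite -divn_eq ltn_pmod //; lia.
Qed.

(** Let s be the remainder of [r]. Without a carry this is c+s+1 <= (c+1)(s+1). With c+s = q-1+s' it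
    is q(s'+1) <= (c+1)(s+1), which holds because s' <= c. *)
Lemma min_distD r c : (c < q)%N -> (min_dist (c + r) <= c.+1 * min_dist r)%N.
Proof.
move=> cq; have [u [s [ltsq ->]]] := min_dist_decomp r.
rewrite addnCA (min_distE u ltsq) mulnA.
have [lt_sc|ge_sc] := ltnP (c + s) (q - 1).
  by rewrite min_distE // leq_mul2r; apply/orP; right; nia.
have [s' Es'] : exists s', (c + s = q - 1 + s')%N.
  by exists (c + s - (q - 1))%N; lia.
rewrite Es' addnA -mulSnr min_distE; last by lia.
rewrite expnS mulnA leq_mul2r; apply/orP; right.
have -> : (s.+1 = s'.+1 + (q - c.+1))%N by lia.
have -> : (q = c.+1 + (q - c.+1))%N by lia.
by move: (q - c.+1)%N Es' => d Es'; nia.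
Qed.

Lemma min_dist_mono : {homo min_dist : r r' / (r <= r')%N}.
Proof.
apply: homo_leq => [//|r1 r2 r3|r]; first exact: leq_trans.
have [u [s [ltsq ->]]] := min_dist_decomp r.
rewrite (min_distE u ltsq) -addnS.
have [lt_s|ge_s] := ltnP s.+1 (q - 1).
  by rewrite min_distE // leq_mul2r ltnW ?orbT.
have -> : (s.+1 = q - 1 + 0)%N by lia.
rewrite addnA -mulSnr min_distE; last by lia.
by rewrite expnS mul1n leq_mul2r; lia.
Qed.

(** The number of monomials with all exponents below [q] that are divisible by x^e. *)
Fixpoint footprint (m : nat) : power 'I_q m -> nat :=
  if m is m'.+1 then fun e => ((q - e.1) * footprint e.2)%N else fun=> 1%N.

(** For the complementary exponents c_i the factors are c_i + 1, and the c_i sum to the argument of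
    [min_dist]; [min_distD] absorbs one variable at a time. *)
Lemma footprint_ge m (e : power 'I_q m) :
  (min_dist (m * (q - 1) - mdeg e) <= footprint e)%N.
Proof.
have -> : (m * (q - 1) - mdeg e = mdeg (mcompl e))%N.
  by rewrite -(mdeg_compl e) addnK.
elim: m e => [|m IHm] => [[]|[i e]] /=.
  by rewrite /min_dist mod0n div0n.
apply: leq_trans (min_distD _ _) _; first by have := ltn_ord i; lia.
have -> : ((q - i.+1).+1 = q - i)%N by have := ltn_ord i; lia.
by rewrite leq_mul2l IHm orbT.
Qed.

End Distance.

(** * Counting monomials *)

Section Dimension.
Variable q : nat.
Hypothesis q_gt0 : (0 < q)%N.

Definition nmon (m a : nat) : nat := #|[set e : power 'I_q m | (mdeg e <= a)%N]|.

Lemma nmonS m a :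
  nmon m.+1 a = (\sum_(j < q) if (j <= a)%N then nmon m (a - j) else 0)%N.
Proof.
rewrite /nmon -sum1dep_card /=.
rewrite -(pair_big_dep xpredT
  (fun (j : 'I_q) (e : power 'I_q m) => j + mdeg e <= a)%N (fun _ _ => 1%N)) /=.
apply: eq_bigr => j _; case: ifP => leja.
  by rewrite -sum1dep_card; apply: eq_bigl => e; rewrite leq_subRL.
by rewrite big1 // => e; have := leja; lia.
Qed.

(** Both sides are the sum over j <= q of the counts in [m] variables at a+1-j, with j = q split off
    on the left and j = 0 on the right. *)
Lemma nmonSS m a :
  (nmon m.+1 a.+1 + (if (q <= a.+1)%N then nmon m (a.+1 - q) else 0) =
   nmon m.+1 a + nmon m a.+1)%N.
Proof.
rewrite !nmonS.
pose f j := (if (j <= a.+1)%N then nmon m (a.+1 - j) else 0)%N.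
rewrite -[X in (_ + X)%N]/(f q) -(big_ord_recr q (fun j => f j)) /=.
by rewrite big_ord_recl /f /= subn0 addnC.
Qed.

Lemma kRM0 m : kRM q m 0 = 1.
Proof.
rewrite /kRM big_ord_recl big1 ?addr0 /= => [|i _].
  by rewrite mul0n subn0 addn0 expr0 mul1r bin0.
by rewrite leqn0 muln_eq0 /= (gtn_eqF q_gt0) mulr0.
Qed.

(** This is the recurrence of [nmonSS]. Pascal's rule for the binomial in [T] lowers a+1 to a; for
    ['C(m.+1, i)] it gives two sums, and an index shift turns the second into minus the value at
    a+1-q. *)
Lemma kRMSS m a :
  kRM q m.+1 a.+1 + (if (q <= a.+1)%N then kRM q m (a.+1 - q) else 0) =
  kRM q m.+1 a + kRM q m a.+1.
Proof.
pose T (n b i : nat) : int :=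
  if (i * q <= b)%N then ('C(n + b - i * q, b - i * q))%:Z else 0.
have TSS i : T m.+1 a.+1 i = T m.+1 a i + T m a.+1 i.
  rewrite /T; have [le_a|lt_a] := leqP (i * q) a.
    rewrite (leq_trans le_a) // subSn //.
    have -> : (m.+1 + a.+1 - i * q = (m.+1 + a - i * q).+1)%N by lia.
    by rewrite binS PoszD addrC addnS addSn.
  (* Boundary case iq = a+1: the term for [a] is absent and both other binomials have lower entry
     0. *)
  have [le_a|//] := leqP (i * q) a.+1.
  have -> : (i * q = a.+1)%N by lia.
  by rewrite subnn !bin0.
have TS i : T m a.+1 i.+1 = if (q <= a.+1)%N then T m (a.+1 - q)%N i else 0.
  rewrite /T mulSn; case: (leqP q a.+1) => leq; last by rewrite ifF //; lia.
  rewrite leq_subRL //; case: ifP => // _.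
  by rewrite addnBA // !subnDA.
have -> : kRM q m.+1 a.+1 = kRM q m.+1 a +
    \sum_(i < m.+2) ((-1) ^+ i * ('C(m.+1, i))%:Z * T m a.+1 i).
  rewrite /kRM -big_split; apply: eq_bigr => i _.
  by rewrite /= -mulrDr -TSS.
rewrite -addrA; congr (_ + _).
rewrite big_ord_recl /=.
under eq_bigr => i _ do rewrite /bump /= add1n binS PoszD mulrDr mulrDl.
rewrite big_split /= [X in X + _]addrA -[LHS]addrA.
set A := (X in X + _ = _); set B := (X in _ + X = _).
have -> : A = kRM q m a.+1.
  have := @big_ord_recl _ (0 : int) +%R m.+1
    (fun i => (-1) ^+ i * ('C(m, i))%:Z * T m a.+1 i).
  rewrite big_ord_recr /= bin_small // mulr0 mul0r addr0.
  by rewrite /A !bin0 => /esym.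
rewrite /B; under eq_bigr => i _ do rewrite TS exprS -!mulrA mulN1r mulrA.
rewrite sumrN; case: ifP => _; first by rewrite addNr addr0.
by rewrite big1 ?subr0 ?oppr0 ?addr0 // => i _; rewrite mulr0.
Qed.

(** Both sides obey the same recurrence in [m] and [a], with the same boundary values. *)
Lemma nmonE m a : (nmon m a)%:Z = kRM q m a.
Proof.
elim: m a => [|m IHm] a.
  rewrite /kRM big_ord1 /= mul0n !subn0 add0n binn /nmon.
  have -> : [set e : power 'I_q 0 | (mdeg e <= a)%N] = setT.
    by apply/setP => -[]; rewrite !inE.
  by rewrite cardsT card_unit binn.
elim: a => [|a IHa].
  rewrite kRM0 nmonS (bigD1 (Ordinal q_gt0)) //= subn0.
  rewrite big1 ?addn0 ?IHm ?kRM0 // => j.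
  by rewrite -val_eqE leqn0 /= => /negPf->.
apply: (addIr (if (q <= a.+1)%N then kRM q m (a.+1 - q) else 0)).
rewrite kRMSS -IHa -(IHm a.+1) -PoszD -nmonSS PoszD; congr (_ + _).
by case: ifP.
Qed.

End Dimension.

(** * Reed-Muller codes *)

Section Evaluation.
Variable F : finFieldType.
Local Notation q := #|F|.

Fixpoint mon (m : nat) : power 'I_q m -> power F m -> F :=
  if m is m'.+1 then fun e x => x.1 ^+ e.1 * mon e.2 x.2 else fun _ _ => 1.

Definition ev m (c : {ffun power 'I_q m -> F}) : {ffun power F m -> F} :=
  [ffun x => \sum_e c e * mon e x].

Lemma evB m (c c' : {ffun power 'I_q m -> F}) : ev (c - c') = ev c - ev c'.
Proof.
apply/ffunP => x; rewrite !ffunE -sumrB; apply: eq_bigr => e _.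
by rewrite !ffunE mulrBl.
Qed.

Lemma card_finField_gt1 : (1 < q)%N.
Proof. by rewrite (cardD1 0) (cardD1 1) !inE oner_neq0. Qed.

(** For j = 0 the sum is [q] ones, and shifting a to a+1 in the sum of all a shows that it is 0. For
    j > 0, scaling by c multiplies the sum by c^j; some nonzero c has c^j different from 1, as X^j -
    1 has at most j < q-1 roots. *)
Lemma sum_expf_small j : (j < q - 1)%N -> \sum_(a : F) a ^+ j = 0.
Proof.
case: j => [_|j lt_jq].
  have: \sum_(a : F) a = \sum_(a : F) (a + 1).
    exact: (reindex_inj (addIr 1)).
  rewrite big_split /= -[LHS]addr0 => /addrI sum1.
  by rewrite [RHS]sum1; apply: eq_bigr.
have [c c0 cj] : exists2 c : F, c != 0 & c ^+ j.+1 != 1.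
  apply/exists_inP; apply: contraTT lt_jq; rewrite negb_exists_in -leqNgt.
  move=> /forall_inP cj; pose P : {poly F} := 'X^(j.+1) - 1.
  have P0 : P != 0 by rewrite -size_poly_eq0 size_XnsubC.
  have := max_poly_roots P0 _ (enum_uniq (predC1 (0 : F))).
  rewrite -cardE cardC1 size_XnsubC // ltnS subn1; apply.
  apply/allP => c; rewrite mem_enum => /cj; rewrite negbK => /eqP cj1.
  by rewrite /root !hornerE cj1 subrr.
apply/eqP; set S := (X in X == _).
have: S = c ^+ j.+1 * S.
  rewrite mulr_sumr /S (reindex_inj (mulfI c0)) /=.
  by apply: eq_bigr => a _; rewrite exprMn.
move/eqP; rewrite -subr_eq0 -[X in X - _]mul1r -mulrBl mulf_eq0 subr_eq0.
by rewrite eq_sym (negPf cj).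
Qed.

Lemma sum_expf_pred_card : \sum_(a : F) a ^+ (q - 1) = -1.
Proof.
have q_gt1 := card_finField_gt1.
(* The summand is -1 at 0 and vanishes elsewhere; the subtracted ones sum to 0. *)
have: \sum_(a : F) (a ^+ (q - 1) - 1) = -1.
  rewrite (bigD1 0) //= expr0n subn_eq0 leqNgt q_gt1 /= sub0r big1 ?addr0 //.
  move=> a a0; apply/eqP; rewrite subr_eq0; apply/eqP/(mulfI a0).
  by rewrite -exprS subn1 prednK ?expf_card ?mulr1 // ltnW.
by rewrite sumrB (sum_expf_small (j := 0)) ?subr0 // subn_gt0.
Qed.

(** The sum factors over the variables, with exponents e'_i + (q-1-e_i). If e' differs from e, the
    degree bound forces some e'_i < e_i, whose factor vanishes; if e' = e, every factor is -1. *)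
Lemma sum_mon_compl m (e e' : power 'I_q m) : (mdeg e' <= mdeg e)%N ->
  \sum_x mon e' x * mon (mcompl e) x = if e' == e then (-1) ^+ m else 0.
Proof.
have sumS n (i i' : 'I_q) (e1 e1' : power 'I_q n) :
    \sum_(x : power F n.+1) mon ((i', e1') : power 'I_q n.+1) x *
       mon (mcompl ((i, e1) : power 'I_q n.+1)) x =
    (\sum_(a : F) a ^+ (i' + (q - i.+1))) *
      \sum_x mon e1' x * mon (mcompl e1) x.
  rewrite big_distrlr pair_big /=; apply: eq_bigr => [[a x]] _ /=.
  by rewrite mulrACA -exprD.
case: (eqVneq e' e) => [->|]; last first.
  elim: m e e' => [|m IHm] => [[] []|[i e] [i' e']] //.
  rewrite sumS xpair_eqE negb_and /=.
  have [lt_i|lt_i|/val_inj<-] := ltngtP i' i.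
  - have lt_q : (i' + (q - i.+1) < q - 1)%N by have := ltn_ord i; lia.
    by rewrite (sum_expf_small lt_q) mul0r.
  - move=> _ le_e; have lt_e : (mdeg e' < mdeg e)%N.
      by rewrite -(ltn_add2l i) (leq_trans _ le_e) // ltn_add2r.
    rewrite IHm ?mulr0 ?(ltnW lt_e) //.
    by apply: contraTneq lt_e => ->; rewrite ltnn.
  - by rewrite eqxx leq_add2l => /= ne le_e; rewrite IHm ?mulr0.
move=> _ {e'}; elim: m e => [|m IHm] => [[]|[i e]].
  by rewrite (big_pred1 tt) ?mulr1 // => -[].
rewrite sumS IHm exprS -sum_expf_pred_card; congr (_ * _).
by apply: eq_bigr => a _; congr (_ ^+ _); have := ltn_ord i; lia.
Qed.

Lemma sum_ev_compl m (c : {ffun power 'I_q m -> F}) e :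
    (forall e', c e' != 0 -> (mdeg e' <= mdeg e)%N) ->
  \sum_x ev c x * mon (mcompl e) x = (-1) ^+ m * c e.
Proof.
move=> maxe; under eq_bigr do rewrite ffunE mulr_suml.
rewrite exchange_big /= (bigD1 e) //= [X in _ + X]big1 => [|e' ne].
  under eq_bigr do rewrite -mulrA.
  by rewrite -mulr_sumr sum_mon_compl // eqxx addr0 mulrC.
under eq_bigr do rewrite -mulrA.
rewrite -mulr_sumr; have [->|/maxe le_e] := eqVneq (c e') 0.
  by rewrite mul0r.
by rewrite sum_mon_compl // (negPf ne) mulr0.
Qed.

Lemma exists_max_mon m (c : {ffun power 'I_q m -> F}) : c != 0 ->
  exists2 e, c e != 0 & forall e', c e' != 0 -> (mdeg e' <= mdeg e)%N.
Proof.
move=> c0; have [e0 e0P] : exists e0, c e0 != 0.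
  apply/existsP; apply: contraNT c0; rewrite negb_exists => /forallP c0.
  by apply/eqP/ffunP => e; rewrite ffunE; apply/eqP; rewrite -[_ == _]negbK.
by case: (@arg_maxnP _ e0 (fun e => c e != 0) (@mdeg _ _) e0P) => e; exists e.
Qed.

Lemma ev_eq0 m (c : {ffun power 'I_q m -> F}) : ev c = 0 -> c = 0.
Proof.
move=> evc0; apply/eqP/contraT => /exists_max_mon[e ce0 maxe].
have := sum_ev_compl maxe; rewrite evc0 big1 => [/esym/eqP|x _].
  by rewrite mulf_eq0 signr_eq0 (negPf ce0).
by rewrite ffunE mul0r.
Qed.

Lemma ev_inj m : injective (@ev m).
Proof.
by move=> c c' /eqP; rewrite -subr_eq0 -evB => /eqP/ev_eq0/subr0_eq.
Qed.

Lemma ev_surj m (f : {ffun power F m -> F}) : exists c, f = ev c.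
Proof.
have: f \in codom (@ev m).
  apply: inj_card_onto; first exact: ev_inj.
  by rewrite !card_ffun !card_power card_ord.
by case/codomP=> c ->; exists c.
Qed.

(** As a polynomial in a, the sum has degree [j], hence at most [j] roots. *)
Lemma card_nonroots (g : 'I_q -> F) (j : 'I_q) :
    g j != 0 -> (forall i : 'I_q, (j < i)%N -> g i = 0) ->
  (q - j <= #|[set a : F | \sum_(i < q) a ^+ i * g i != 0]%R|)%N.
Proof.
move=> gj0 g0; pose P := \poly_(i < q) (if insub i is Some i' then g i' else 0).
have hP a : P.[a] = \sum_(i < q) a ^+ i * g i.
  by rewrite horner_poly; apply: eq_bigr => i _; rewrite valK mulrC.
have P0 : P != 0.
  apply: contraNneq gj0 => P0; have := congr1 (fun Q : {poly F} => Q`_j) P0.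
  by rewrite coef_poly ltn_ord valK coef0 => ->.
have sizeP : (size P <= j.+1)%N.
  apply/leq_sizeP => i lt_ji; rewrite coef_poly; case: ifP => // lt_iq.
  by rewrite insubT g0.
have lt_root : (#|root P| < size P)%N.
  rewrite cardE max_poly_roots ?enum_uniq //.
  by apply/allP => a; rewrite mem_enum.
have := leq_trans lt_root sizeP; rewrite ltnS => le_root.
have -> : #|[set a | \sum_(i < q) a ^+ i * g i != 0]| = #|predC (root P)|.
  by apply: eq_card => a; rewrite !inE -hP.
by rewrite leq_subLR -[X in (X <= _)%N](cardC (root P)) leq_add2r.
Qed.

(* The witness is the lexicographically largest monomial of [c]: for each point
   where the leading coefficient in the first variable does not vanish, [ev c]
   restricts to a nonzero polynomial of known degree in that variable. *)
Lemma footprint_bound m (c : {ffun power 'I_q m -> F}) : c != 0 ->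
  exists2 e, c e != 0 & (footprint e <= #|[set x | ev c x != 0]%R|)%N.
Proof.
elim: m c => [|m IHm] c c0.
  have [e ce0 _] := exists_max_mon c0; exists e => //=.
  by apply/card_gt0P; exists tt; rewrite inE ffunE (big_pred1 e) ?mulr1 //.
pose sl (i : 'I_q) : {ffun power 'I_q m -> F} := [ffun e => c (i, e)].
have [i0 i0P] : exists i, sl i != 0.
  have [[i e] ce0 _] := exists_max_mon c0; exists i.
  by apply: contraNneq ce0 => /ffunP/(_ e); rewrite !ffunE => ->.
case: (@arg_maxnP _ i0 (fun i => sl i != 0) (@nat_of_ord q) i0P) => j slj maxj.
have [e sle le_e] := IHm _ slj; exists (j, e) => /=; first by rewrite ffunE in sle.
have evS a x : ev c (a, x) = \sum_(i < q) a ^+ i * ev (sl i) x.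
  rewrite ffunE; under [RHS]eq_bigr do rewrite ffunE mulr_sumr.
  rewrite pair_big /=; apply: eq_bigr => [[i e']] _ /=.
  by rewrite ffunE mulrCA.
have -> : #|[set x | ev c x != 0]| =
    (\sum_x \sum_(a | (ev c (a, x) != 0)%R) 1)%N.
  rewrite (exchange_big_dep xpredT) //= pair_big_dep /= -sum1dep_card.
  by apply: eq_bigl => -[a x].
(* Only the points [x] where the top slice is nonzero are kept; each contributes at least q - j
   values of [a]. *)
apply: leq_trans (_ : \sum_(x in [set x | ev (sl j) x != 0]%R) (q - j) <= _)%N.
  by rewrite sum_nat_const mulnC leq_mul2r le_e orbT.
rewrite big_mkcond; apply: leq_sum => x _; rewrite inE; case: ifP => // evj.
apply: leq_trans (card_nonroots (g := fun i => ev (sl i) x) evj _) _ => [i lt_ji|].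
  have -> : sl i = 0.
    by apply/eqP; apply: contraTT lt_ji => /maxj; rewrite -leqNgt.
  by rewrite ffunE big1 // => e' _; rewrite ffunE mul0r.
rewrite -sum1dep_card; apply: eq_leq; apply: eq_bigl => a.
by rewrite evS.
Qed.

Lemma ev_weight m r (c : {ffun power 'I_q m -> F}) : c != 0 ->
    (forall e, c e != 0 -> (r + mdeg e <= m * (q - 1))%N) ->
  (min_dist q r <= #|[set x | ev c x != 0]%R|)%N.
Proof.
move=> /footprint_bound[e ce0 le_e] degc; apply: leq_trans le_e.
apply: leq_trans (footprint_ge card_finField_gt1 e).
apply: min_dist_mono; rewrite ?card_finField_gt1 // leq_subRL.
all: by have := degc e ce0; lia.
Qed.

End Evaluation.

(** * Descent to the prime field *)

Lemma dual_coordinates (p t : nat) (F : finFieldType) :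
    (0 < t)%N -> p \in [pchar F] -> #|F| = (p ^ t)%N ->
  exists (lam : F -> 'F_p) (phi psi : F -> {ffun 'I_t -> 'F_p}),
  [/\ {morph lam : x y / x + y} /\ exists z, lam z != 0,
      {morph phi : x y / x - y} /\ injective phi,
      {morph psi : x y / x - y} /\ bijective psi &
      forall x y, \sum_i psi x i * phi y i = lam (x * y)].
Proof.
move=> t_gt0 pcharF cardF; have p_pr := pcharf_prime pcharF.
pose L := pPrimeCharType pcharF.
have dimL : t = \dim {: L : vectType 'F_p}.
  by rewrite pprimeChar_dimf cardF lognX logn_prime // eqxx muln1.
subst t; set t := (\dim _) in t_gt0 cardF *.
pose b : t.-tuple L := vbasis {: L : vectType 'F_p}.
pose lam (x : L) : 'F_p := coord b (Ordinal t_gt0) x.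
have lamD : {morph lam : x y / x + y} by move=> x y; exact: raddfD.
have lam_nz : lam b`_0 != 0.
  rewrite /lam (coord_free (Ordinal t_gt0) (Ordinal t_gt0)) ?eqxx ?oner_neq0 //.
  exact: basis_free (vbasisP _).
have lamB : {morph lam : x y / x - y} by move=> x y; exact: raddfB.
have coordE (x : L) : x = \sum_(i < t) coord b i x *: b`_i.
  exact: coord_vbasis (memvf x).
have psiphi (x y : L) : \sum_(i < t) lam (b`_i * x) * coord b i y = lam (x * y).
  rewrite {2}(coordE y) mulr_sumr /lam linear_sum; apply: eq_bigr => i _.
  by rewrite -scalerAr linearZ /= mulrC [x * _]mulrC.
exists lam, (fun y : L => [ffun i => coord b i y]),
  (fun x : L => [ffun i : 'I_t => lam (b`_i * x)]).
split.
- by split=> //; exists b`_0.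
- split=> [x y|x y /ffunP eqxy].
    by apply/ffunP => i; rewrite !ffunE; exact: raddfB.
  rewrite [x]coordE [y]coordE; apply: eq_bigr => i _.
  by have := eqxy i; rewrite !ffunE => ->.
- have psiB : {morph (fun x : L => [ffun i : 'I_t => lam (b`_i * x)]) : x y / x - y}.
    by move=> x y; apply/ffunP => i; rewrite !ffunE -lamB -mulrBr.
  split=> //; apply: inj_card_bij; last first.
    by rewrite card_ffun card_Fp // card_ord cardF.
  move=> x y /eqP; rewrite -subr_eq0 -psiB => /eqP/ffunP xy0; apply/subr0_eq/eqP.
  (* If [lam] kills every b_i d with d = x - y nonzero, it kills all multiples of d, in particular
     b_0 = d (b_0 / d). *)
  apply: contraNT lam_nz => nz; rewrite -[b`_0](mulVKf nz) -psiphi.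
  by rewrite big1 // => i _; have := xy0 i; rewrite !ffunE => ->; rewrite mul0r.
- by move=> x y; rewrite -psiphi; apply: eq_bigr => i _; rewrite !ffunE.
Qed.

Section Expansion.
Variables (p t n : nat) (F : finFieldType) (T : finType).
Variable h : 'I_n -> 'I_t * T.
Hypothesis h_bij : bijective h.

Definition expand (phi : F -> {ffun 'I_t -> 'F_p}) (f : {ffun T -> F}) :
  qlabel p n := [ffun i => phi (f (h i).2) (h i).1].

Lemma expandB phi :
  {morph phi : x y / x - y} -> {morph expand phi : f g / f - g}.
Proof. by move=> phiB f g; apply/ffunP => i; rewrite !ffunE phiB !ffunE. Qed.

(** A nonzero symbol has a nonzero coordinate, so projecting the support of the expansion to [T]
    covers the support of [f]. *)
Lemma expand_weight phi (f : {ffun T -> F}) :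
    {morph phi : x y / x - y} -> injective phi ->
  (#|[set x | f x != 0]%R| <= qwt (expand phi f))%N.
Proof.
move=> phiB phi_inj; have [g gK hK] := h_bij.
apply: leq_trans (leq_imset_card (fun i => (h i).2) _).
apply/subset_leq_card/subsetP => x; rewrite inE => fx.
have [j phij] : exists j, phi (f x) j != 0.
  apply/existsP; apply: contraNT fx; rewrite negb_exists => /forallP phi0.
  apply/eqP/phi_inj/ffunP => j; rewrite -[0](subrr (0 : F)) phiB subrr ffunE.
  by apply/eqP; rewrite -[_ == _]negbK.
by apply/imsetP; exists (g (j, x)); rewrite ?inE ?ffunE hK.
Qed.

Lemma qdot_expand (lam : F -> 'F_p) (phi psi : F -> {ffun 'I_t -> 'F_p}) f g :
    {morph lam : x y / x + y} ->
    (forall x y, \sum_i psi x i * phi y i = lam (x * y)) ->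
  qdot (expand psi f) (expand phi g) = lam (\sum_x f x * g x).
Proof.
move=> lamD dot.
have lam0 : lam 0 = 0 by apply: (addrI (lam 0)); rewrite -lamD !addr0.
rewrite (big_morph lam lamD lam0).
under [RHS]eq_bigr do rewrite -dot.
rewrite exchange_big pair_big /= (reindex h) /=; last exact: onW_bij.
by apply: eq_bigr => i _; rewrite !ffunE.
Qed.

Lemma expand_surj psi (b : qlabel p n) :
  bijective psi -> exists f, b = expand psi f.
Proof.
move=> [psi' _ psiK]; have [g gK hK] := h_bij.
exists [ffun x => psi' [ffun j => b (g (j, x))]].
by apply/ffunP => i; rewrite !ffunE psiK ffunE -surjective_pairing gK.
Qed.

End Expansion.

Lemma card_supported (E : finType) (R : finNzRingType) (S : {set E}) :
  #|[set c : {ffun E -> R} | support c \subset S]| = (#|R| ^ #|S|)%N.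
Proof.
rewrite -(card_pffun_on 0); apply: eq_card => c; rewrite inE.
by apply/idP/pffun_onP => [sc | []]; first split.
Qed.

Lemma unsupported_eq0 (E : finType) (R : nzRingType) (S : {set E})
    (c : {ffun E -> R}) e :
  support c \subset S -> e \notin S -> c e = 0.
Proof.
move=> /subsetP/(_ e) sc eS; apply/eqP; apply: contraNT eS => nz.
by apply: sc; rewrite inE.
Qed.

(** Complementing exponents is a bijection, so the layer that indexes the coset representatives has
    k(a2) - k(a1) monomials. *)
Lemma card_compl_layer q m a1 a2 : (a1 <= a2)%N ->
  (nmon q m a2 =
   nmon q m a1 + #|[set e : power 'I_q m | a1 < mdeg (mcompl e) <= a2]|)%N.
Proof.
move=> le_a; have -> : [set e : power 'I_q m | (a1 < mdeg (mcompl e) <= a2)%N] =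
    @mcompl q m @^-1: [set e | (a1 < mdeg e <= a2)%N].
  by apply/setP => e; rewrite !inE.
rewrite on_card_preimset; last by exists (@mcompl q m) => e _; apply: mcomplK.
rewrite /nmon -(cardsID [set e : power 'I_q m | (mdeg e <= a1)%N]).
congr (_ + _)%N; apply: eq_card => e; rewrite !inE.
  by apply: andb_idl => /leq_trans->.
by rewrite -ltnNge.
Qed.

(** * The quantum code of a nested pair of Reed-Muller codes *)

Section ReedMullerCode.
Variables (p t m a1 a2 : nat) (F : finFieldType).
Local Notation q := #|F|.
Local Notation n := (t * q ^ m)%N.
Hypotheses (t_gt0 : (0 < t)%N) (pcharF : p \in [pchar F]).
Hypotheses (cardF : q = (p ^ t)%N) (le_a : (a1 <= a2)%N).
Hypothesis lt_a2 : (a2 < m * (q - 1))%N.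

(* With [N := m * (q - 1)], a monomial [e] satisfies [a < mdeg (mcompl e)]
   exactly when its degree is at most [N - 1 - a], so these conditions cut out
   the dual code of order [N - 1 - a] without truncated subtractions. *)
Lemma RM_coset_code :
  is_AQECC p n
    (t * #|[set e : power 'I_q m | a1 < mdeg (mcompl e) <= a2]|)%N
    (min_dist q (m * (q - 1) - a2)) (min_dist q a1.+1).
Proof.
have [lam [phi [psi [[lamD [z lamz]] [phiB phi_inj] [psiB psi_bij] dot]]]] :=
  dual_coordinates t_gt0 pcharF cardF.
have p_pr := pcharf_prime pcharF; have q_gt1 := card_finField_gt1 F.
have card_n : #|{: 'I_t * power F m}| = n.
  by rewrite card_prod card_ord card_power.
pose h (i : 'I_n) : 'I_t * power F m := enum_val (cast_ord (esym card_n) i).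
have h_bij : bijective h.
  apply: inj_card_bij; last by rewrite card_n card_ord.
  by move=> i j /enum_val_inj/cast_ord_inj.
set S := [set e | _].
pose A := [set c : {ffun power 'I_q m -> F} | support c \subset S].
pose B := [set c : {ffun power 'I_q m -> F} |
            support c \subset [set e | (a2 < mdeg (mcompl e))%N]].
have card_A : #|A| = (p ^ (t * #|S|))%N by rewrite card_supported expnM -cardF.
pose msg (i : 'I_(p ^ (t * #|S|))) := enum_val (cast_ord (esym card_A) i).
pose enc c := expand h phi (ev c).
have encB : {morph enc : c c' / c - c'}.
  by move=> c c'; rewrite /enc evB; apply: expandB.
have enc0 : enc 0 = 0 by rewrite -(subrr 0) encB subrr.
have encN c : enc (- c) = - enc c by rewrite -sub0r encB enc0 sub0r.
have encD : {morph enc : c c' / c + c'}.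
  by move=> c c'; rewrite -{1}[c']opprK encB encN opprK.
have B0 : 0 \in B by rewrite inE; apply/subsetP => e; rewrite !inE ffunE eqxx.
have B_eq0 c e : c \in B -> ~~ (a2 < mdeg (mcompl e))%N -> c e = 0.
  by rewrite inE => cB eB; apply: unsupported_eq0 cB _; rewrite inE.
have msg_eq0 i e : ~~ (a1 < mdeg (mcompl e) <= a2)%N -> msg i e = 0.
  have := enum_valP (cast_ord (esym card_A) i); rewrite inE => cA eA.
  by apply: unsupported_eq0 cA _; rewrite inE.
have BB c c' : c \in B -> c' \in B -> c - c' \in B.
  move=> Bc Bc'; rewrite inE; apply/subsetP => e; rewrite !inE !ffunE.
  by apply: contraNT => eB; rewrite !(B_eq0 _ e) // subrr.
apply: (@coset_code_AQECC _ _ p_pr (enc @: B) _ _ _ _ _ (enc \o msg)).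
- by apply/imsetP; exists 0.
- move=> _ _ /imsetP[c Bc ->] /imsetP[c' Bc' ->].
  by rewrite -encB; apply/imset_f/BB.
- exact: min_dist_gt0.
- exact: min_dist_gt0.
- move=> i j _ /imsetP[c Bc ->] /=; rewrite -encB -encD => lt_wt.
  have c0 : msg j - msg i + c = 0.
    apply: contraTeq lt_wt => nz; rewrite -leqNgt.
    apply: leq_trans (expand_weight h_bij _ phiB phi_inj).
    (* All monomials of [msg j - msg i + c] have degree at most m(q-1) - (a1+1). *)
    apply: ev_weight nz _ => e ce0.
    rewrite -(mdeg_compl e) leq_add2r.
    apply: contraNT ce0 => le_a1; rewrite !ffunE !msg_eq0 ?(negPf le_a1) //.
    rewrite (B_eq0 c) ?subrr ?addr0 //; apply: contraNN le_a1.
    exact: leq_ltn_trans.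
  rewrite c0 enc0; split=> //.
  suff: msg i = msg j by move/enum_val_inj/cast_ord_inj.
  (* Messages and elements of [B] have disjoint supports, so the vanishing sum splits. *)
  apply/ffunP => e; have [lt_e|ge_e] := boolP (a2 < mdeg (mcompl e))%N.
    by rewrite !msg_eq0 // andbC negb_and -ltnNge lt_e.
  move/ffunP/(_ e): c0; rewrite !ffunE (B_eq0 c) // addr0.
  by move/eqP; rewrite subr_eq0 eq_sym => /eqP.
- move=> b; have [f ->] := expand_surj h_bij b psi_bij.
  have [c ->] := ev_surj f => b0 lt_wt.
  have c0 : c != 0.
    apply: contraNneq b0 => ->.
    have := evB (0 : {ffun power 'I_q m -> F}) 0; rewrite !subrr => ->.
    by have := expandB h psiB 0 0; rewrite !subrr => ->.
  have [e ce0 maxe] := exists_max_mon c0.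
  (* Top degree at most [a2] would give [b] weight at least the distance of the code of order [a2].
     Degree above [a2] makes the complement of [e] a monomial allowed in [B]. *)
  have lt_e : (a2 < mdeg e)%N.
    apply: contraTT lt_wt; rewrite -!leqNgt => le_e.
    apply: leq_trans (expand_weight h_bij _ psiB (bij_inj psi_bij)).
    apply: ev_weight c0 _ => e' /maxe le_e'.
    by rewrite -[X in (_ <= X)%N](subnK (ltnW lt_a2)) leq_add2l (leq_trans le_e').
  (* The complementary monomial, scaled so that its pairing with [ev c] is exactly [z], where [lam]
     is nonzero. *)
  pose y : {ffun power 'I_q m -> F} :=
    [ffun e' => if e' == mcompl e then z / ((-1) ^+ m * c e) else 0].
  exists (enc y).
    apply: imset_f; rewrite inE; apply/subsetP => e'; rewrite !inE ffunE.
    by have [->|] := eqVneq e' (mcompl e); rewrite ?mcomplK // eqxx.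
  rewrite (qdot_expand h_bij _ _ lamD dot).
  suff -> : \sum_x ev c x * ev y x = z by [].
  have evy x : ev y x = z / ((-1) ^+ m * c e) * mon (mcompl e) x.
    rewrite ffunE (bigD1 (mcompl e)) //= ffunE eqxx big1 ?addr0 // => e' ne.
    by rewrite ffunE (negPf ne) mul0r.
  under eq_bigr do rewrite evy mulrCA.
  by rewrite -mulr_sumr sum_ev_compl // divfK // mulf_neq0 ?signr_eq0.
Qed.

End ReedMullerCode.

Theorem theorem10 (p t m alpha1 alpha2 : nat) :
  prime p -> (1 <= t)%N -> (1 <= m)%N ->
  (alpha1 <= alpha2)%N -> (alpha2 < m * (p ^ t - 1))%N ->
  let q := (p ^ t)%N in
  exists k dz dx : nat,
    k%:Z = t%:Z * (kRM q m alpha2 - kRM q m alpha1) /\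
    (dRM q m alpha2 <= dz)%N /\
    (dRMperp q alpha1 <= dx)%N /\
    is_AQECC p (t * q ^ m) k dz dx.
Proof.
move=> p_pr t_gt0 _ le_a lt_a2 q.
have [F pcharF cardF] := pPrimePowerField p_pr t_gt0.
rewrite /q -cardF in lt_a2 *.
have q_gt0 : (0 < #|F|)%N by apply/card_gt0P; exists 0.
exists (t * #|[set e : power 'I_#|F| m | alpha1 < mdeg (mcompl e) <= alpha2]|)%N.
exists (min_dist #|F| (m * (#|F| - 1) - alpha2)), (min_dist #|F| alpha1.+1).
(* [dRM] and [dRMperp] unfold to these values of [min_dist], so both distance bounds hold with
   equality. *)
split; last by do 2!split=> //; apply: RM_coset_code.
rewrite -!nmonE // (card_compl_layer _ _ le_a) PoszD PoszM.
by rewrite addrAC subrr add0r.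
Qed.
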